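(* The following equalities of classes hold: $$\mathbb{K}_{\mathbf{mbCciw}}=\{\mathcal{B}\in\mathbb{K}_{\mathbf{mbC}} : \mathcal{M}(\mathcal{B})\text{ validates }(\mathbf{ciw})\}=\{\mathcal{B}\in\mathbb{K}_{\mathbf{CPL}^+_{\mathbf e}} : \mathcal{M}(\mathcal{B})\text{ validates }(\mathbf{Ax10}),(\mathbf{bc1})\text{ and }(\mathbf{ciw})\}.$$
   Context: Let $\Sigma=\{\wedge,\vee,\to,\neg,\circ\}$ ($\neg,\circ$ unary, the others binary); $For(\Sigma)$ is the set of formulas over $\Sigma$ generated by a denumerable set of propositional variables. A multialgebra over $\Sigma$ is a nonempty set with operations whose values are nonempty subsets. For a Boolean algebra $\mathcal{A}$ with domain $A$ (the one-element Boolean algebra is allowed) and $z\in A^3$ write $z=(z_1,z_2,z_3)$. A swap structure for $\mathbf{CPL}^+_{\mathbf e}$ over $\mathcal{A}$ is a multialgebra $\mathcal{B}$ over $\Sigma$ with domain $|\mathcal{B}|=B\subseteq A^3$ such that $0\in\{z_1:z\in B\}$ and for all $z,w\in B$: $\emptyset\ne z\#w\subseteq\{u\in B: u_1=z_1\# w_1\}$ for $\#\in\{\wedge,\vee,\to\}$; $\emptyset\neq\neg z\subseteq\{u\in B:u_1=z_2\}$; $\emptyset\ne\circ z\subseteq\{u\in B:u_1=z_3\}$. $\mathbb{K}_{\mathbf{CPL}^+_{\mathbf e}}$ is the class of all of these, over arbitrary Boolean algebras. $\mathbb{K}_{\mathbf{mbC}}$ consists of those with $B\subseteq\{z\in A^3: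 z_1\vee z_2=1,\ z_1\wedge z_2\wedge z_3=0\}$, and $\mathbb{K}_{\mathbf{mbCciw}}$ of those in $\mathbb{K}_{\mathbf{mbC}}$ for which in addition $z_3\vee(z_1\wedge z_2)=1$ for all $z\in B$. $\mathcal{M}(\mathcal{B})=(\mathcal{B},D_{\mathcal{B}})$ is the Nmatrix with designated set $D_{\mathcal{B}}=\{z\in B: z_1=1\}$. A valuation over $\mathcal{M}(\mathcal{B})$ is $v:For(\Sigma)\to B$ with $v(\alpha\#\beta)\in v(\alpha)\#v(\beta)$, $v(\neg\alpha)\in\neg v(\alpha)$, $v(\circ\alpha)\in\circ v(\alpha)$. $\mathcal{M}(\mathcal{B})$ validates an axiom schema if $v(\gamma)\in D_{\mathcal{B}}$ for every instance $\gamma$ and every valuation $v$. The schemas are: $(\mathbf{Ax10})$ $\alpha\vee\neg\alpha$; $(\mathbf{bc1})$ $\circ\alpha\to(\alpha\to(\neg\alpha\to\beta))$; $(\mathbf{ciw})$ $\circ\alpha\vee(\alpha\wedge\neg\alpha)$. *)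

(* Defs.v *)
From mathcomp Require Import all_boot all_order.
From mathcomp Require Import boolp classical_sets.

Set Implicit Arguments.
Unset Strict Implicit.
Unset Printing Implicit Defensive.

Local Open Scope classical_set_scope.

Inductive unop : Type := Neg | Circ.
Inductive binop : Type := And | Or | Imp.

Inductive form : Type :=
| Var of nat
| Un of unop & form
| Bin of binop & form & form.

Record multialgebra (T : Type) : Type := Multialgebra {
  carrier_inhabited : inhabited T;
  mun : unop -> T -> set T;
  mbin : binop -> T -> T -> set T;
  mun_nonempty : forall o x, mun o x !=set0;
  mbin_nonempty : forall o x y, mbin o x y !=set0
}.

Record nmatrix (T : Type) : Type := Nmatrix {
  nm_alg : multialgebra T;
  designated : set T
}.

Definition valuation (T : Type) (M : nmatrix T) (v : form -> T) : Prop :=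
  (forall o a, mun (nm_alg M) o (v a) (v (Un o a))) /\
  (forall o a b, mbin (nm_alg M) o (v a) (v b) (v (Bin o a b))).

(* An axiom schema is represented by the set of its instances. *)
Definition validates (T : Type) (M : nmatrix T) (S : set form) : Prop :=
  forall c, S c -> forall v, valuation M v -> designated M (v c).

Definition Ax10 : set form :=
  [set c | exists a, c = Bin Or a (Un Neg a)].

Definition bc1 : set form :=
  [set c | exists a b,
     c = Bin Imp (Un Circ a) (Bin Imp a (Bin Imp (Un Neg a) b))].

Definition ciw : set form :=
  [set c | exists a, c = Bin Or (Un Circ a) (Bin And a (Un Neg a))].

(* [ctbDistrLatticeType] does not require [\bot != \top], so the one-element
   Boolean algebra is included. The Boolean algebra is part of the data since
   the designated elements depend on it; the operations are defined on the
   subtype of triples belonging to [dom]. *)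
Record triple_multialgebra : Type := TripleMultialgebra {
  disp : Order.disp_t;
  balg : ctbDistrLatticeType disp;
  dom : set (balg * balg * balg);
  malg : multialgebra (set_type dom)
}.

Arguments dom : clear implicits.

Definition fst3 (B : triple_multialgebra) (z : dom B) : balg B := (val z).1.1.
Definition snd3 (B : triple_multialgebra) (z : dom B) : balg B := (val z).1.2.
Definition thd3 (B : triple_multialgebra) (z : dom B) : balg B := (val z).2.

Definition bool_bin (d : Order.disp_t) (A : ctbDistrLatticeType d)
    (o : binop) (x y : A) : A :=
  match o with
  | And => (x `&` y)%O
  | Or => (x `|` y)%O
  | Imp => (~` x `|` y)%O
  end.

Definition swap_un (B : triple_multialgebra) (o : unop) (z : dom B) : balg B :=
  match o with
  | Neg => snd3 z
  | Circ => thd3 z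
  end.

(* Not [set triple_multialgebra]: the universe of [set] lies
   strictly below that of [ctbDistrLatticeType]. *)
Definition class : Type := triple_multialgebra -> Prop.

Definition K_CPLe : class := fun B =>
  (exists z : dom B, fst3 z = \bot%O) /\
  (forall o (z w : dom B),
     mbin (malg B) o z w `<=` [set u | fst3 u = bool_bin o (fst3 z) (fst3 w)]) /\
  (forall o (z : dom B),
     mun (malg B) o z `<=` [set u | fst3 u = swap_un o z]).

Definition K_mbC : class := fun B =>
  K_CPLe B /\
  forall z : dom B, (fst3 z `|` snd3 z = \top)%O /\
    (fst3 z `&` snd3 z `&` thd3 z = \bot)%O.

Definition K_mbCciw : class := fun B =>
  K_mbC B /\
  forall z : dom B, (thd3 z `|` (fst3 z `&` snd3 z) = \top)%O.

Definition swap_nmatrix (B : triple_multialgebra) : nmatrix (dom B) :=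
  Nmatrix (malg B) [set z | fst3 z = \top%O].

(* Main.v *)
(* The three components of a snapshot z are the values of a formula, of its
   negation and of its consistency, so in a valuation the first component of an
   instance of Ax10, bc1 or ciw is a Boolean expression in the snapshots of the
   metavariables. As every assignment to the propositional variables extends to
   a valuation, validity of a schema is a Boolean identity over all snapshots;
   for bc1, the metavariable beta is sent to a snapshot with first component 0. *)
Require Import Defs.
From mathcomp Require Import all_boot all_order.
From mathcomp Require Import boolp classical_sets.

Set Implicit Arguments.
Unset Strict Implicit.
Unset Printing Implicit Defensive.

Import Order.Theory.
Local Open Scope order_scope.

(** Formulas are freely generated, so recursion applies; choice selects one element of each nonempty
    value set. *)
Fixpoint extend (T : Type) (M : multialgebra T) (e : nat -> T) (c : form) : T :=
  match c with
  | Var n => e n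
  | Un o a => sval (cid (mun_nonempty M o (extend M e a)))
  | Bin o a b => sval (cid (mbin_nonempty M o (extend M e a) (extend M e b)))
  end.

Lemma extend_valuation (T : Type) (M : nmatrix T) (e : nat -> T) :
  exists2 v, valuation M v & forall n, v (Var n) = e n.
Proof.
by exists (extend (nm_alg M) e) => //; split=> [o a|o a b] /=; case: cid.
Qed.

(** By De Morgan, the nested implication is the complement of the triple meet, joined with [b]. *)
Lemma imp3_eq1 (d : Order.disp_t) (A : ctbDistrLatticeType d) (x y z b : A) :
  x `&` y `&` z = \bot -> ~` z `|` (~` x `|` (~` y `|` b)) = \top.
Proof.
move=> h; rewrite !joinA -!complI.
have -> : z `&` x `&` y = \bot by rewrite -meetA meetC h.
by rewrite compl0 join1x.
Qed.

Lemma imp3_eq1_bot (d : Order.disp_t) (A : ctbDistrLatticeType d) (x y z : A) :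
  ~` z `|` (~` x `|` (~` y `|` \bot)) = \top -> x `&` y `&` z = \bot.
Proof.
rewrite joinx0 -!complI => h.
by rewrite meetC; apply: compl_inj; rewrite h compl0.
Qed.

Section SwapStructure.

Variable B : triple_multialgebra.
Hypothesis CPLeB : K_CPLe B.

(** A valuation chooses its values freely, but the swap conditions fix the first component of every
    possible choice. *)
Lemma fst3_un v (hv : valuation (swap_nmatrix B) v) o a :
  fst3 (v (Un o a)) = swap_un o (v a).
Proof. by case: CPLeB hv => _ [_ hu] [+ _] => /(_ o a) /hu. Qed.

Lemma fst3_bin v (hv : valuation (swap_nmatrix B) v) o a b :
  fst3 (v (Bin o a b)) = bool_bin o (fst3 (v a)) (fst3 (v b)).
Proof. by case: CPLeB hv => _ [hb _] [_ +] => /(_ o a b) /hb. Qed.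

Lemma validates_Ax10 : validates (swap_nmatrix B) Ax10 <->
  forall z : dom B, fst3 z `|` snd3 z = \top.
Proof.
split=> [H z|H _ [a ->] v hv].
  (* The instance at [Var 0] involves no other variable, so a constant assignment suffices. *)
  have [v hv ve] := extend_valuation (swap_nmatrix B) (fun=> z).
  have /= := H _ (ex_intro _ (Var 0) erefl) _ hv.
  by rewrite (fst3_bin hv) (fst3_un hv) /= ve.
by rewrite /= (fst3_bin hv) (fst3_un hv) /= H.
Qed.

Lemma validates_bc1 : validates (swap_nmatrix B) bc1 <->
  forall z : dom B, fst3 z `&` snd3 z `&` thd3 z = \bot.
Proof.
split=> [H z|H _ [a [b ->]] v hv]; last first.
  by rewrite /= !(fst3_bin hv, fst3_un hv) //=; apply: imp3_eq1.
have [z0 z0E] := CPLeB.1.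
(* [Var 0] stands for alpha and [Var 1] for beta; with beta at bottom, the De Morgan form is the
   bare complement of the meet. *)
pose e n := if n is 0 then z else z0.
have [v hv ve] := extend_valuation (swap_nmatrix B) e.
have /= := H _ (ex_intro _ (Var 0) (ex_intro _ (Var 1) erefl)) _ hv.
by rewrite !(fst3_bin hv, fst3_un hv) /= !ve /= z0E => /imp3_eq1_bot.
Qed.

Lemma validates_ciw : validates (swap_nmatrix B) ciw <->
  forall z : dom B, thd3 z `|` (fst3 z `&` snd3 z) = \top.
Proof.
split=> [H z|H _ [a ->] v hv].
  have [v hv ve] := extend_valuation (swap_nmatrix B) (fun=> z).
  have /= := H _ (ex_intro _ (Var 0) erefl) _ hv.
  by rewrite !(fst3_bin hv, fst3_un hv) /= ve.
by rewrite /= !(fst3_bin hv, fst3_un hv) //= H.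
Qed.

End SwapStructure.

Theorem proposition8p4 :
  K_mbCciw = (fun B => K_mbC B /\ validates (swap_nmatrix B) ciw) /\
  (fun B => K_mbC B /\ validates (swap_nmatrix B) ciw) =
  (fun B => K_CPLe B /\ validates (swap_nmatrix B) Ax10 /\
            validates (swap_nmatrix B) bc1 /\ validates (swap_nmatrix B) ciw).
Proof.
split; apply: funext => B; apply: propext.
  by split=> -[mbCB /(validates_ciw mbCB.1)].
(* The two identities that cut [K_mbC] out of [K_CPLe] are exchanged for [Ax10] and [bc1]; [hciw] is
   carried along. *)
split=> [[[CB H] hciw]|[CB [/(validates_Ax10 CB) h10 [/(validates_bc1 CB) hbc hciw]]]].
  split=> //; split; first by apply/(validates_Ax10 CB) => z; case: (H z).
  by split=> //; apply/(validates_bc1 CB) => z; case: (H z).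
by split=> //; split=> // z; split.
Qed.
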